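(* Let $\mathcal{B}$ be a front on $\mathbb{N}$. There is a tall ideal $\mathcal{I}$ on $\mathbb{N}$ which is co-analytic (a $\mathbf{\Pi}^1_1$ subset of $2^{\mathbb{N}}$) such that $hom(\mathcal{F})\not\subseteq\mathcal{I}$ for every $\mathcal{F}\subseteq\mathcal{B}$.
   Context: Subsets of $\mathbb{N}$ are identified with elements of $2^{\mathbb{N}}$. An ideal on $\mathbb{N}$ is a hereditary family closed under finite unions; tall means every infinite $x\subseteq\mathbb{N}$ has an infinite subset in the family. For finite $s$ and $t\subseteq\mathbb{N}$, $s\sqsubseteq t$ means $s=t\cap\{0,\dots,n\}$ for some $n$. A front on an infinite set $x$ is a family $\mathcal{B}\subseteq[x]^{<\omega}$ whose elements are pairwise $\sqsubseteq$-incomparable and such that every infinite $y\subseteq x$ has an initial segment in $\mathcal{B}$. For $\mathcal{F}\subseteq\mathcal{B}$, $hom(\mathcal{F})$ is the set of infinite $y\subseteq\mathbb{N}$ such that either $[y]^{<\omega}\cap\mathcal{B}\subseteq\mathcal{F}$ or $[y]^{<\omega}\cap\mathcal{F}=\emptyset$. *)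

(* Defs.v *)
From mathcomp Require Import all_boot.
Set Implicit Arguments. Unset Strict Implicit. Unset Printing Implicit Defensive.

Definition subsetN (x y : nat -> bool) : Prop := forall n, x n -> y n.
Definition infiniteN (x : nat -> bool) : Prop := forall m, exists n, m <= n /\ x n.

Definition is_ideal (I : (nat -> bool) -> Prop) : Prop :=
  (forall x y, I x -> subsetN y x -> I y) /\
  (forall x y, I x -> I y -> I (fun n => x n || y n)).

Definition tall (I : (nat -> bool) -> Prop) : Prop :=
  forall x, infiniteN x -> exists y, [/\ infiniteN y, subsetN y x & I y].

(* Finite subsets of N are represented canonically by strictly increasing
   lists of naturals. *)
Definition finsetN (s : seq nat) : Prop := sorted ltn s.

Definition initseg (s t : seq nat) : Prop := exists n, s = [seq k <- t | k < n].

Definition initseg_of (s : seq nat) (y : nat -> bool) : Prop :=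
  exists n, s = [seq k <- iota 0 n | y k].

Definition front (B : seq nat -> Prop) (x : nat -> bool) : Prop :=
  [/\ infiniteN x,
      (forall s, B s -> finsetN s /\ all x s),
      (forall s t, B s -> B t -> initseg s t -> s = t) &
      (forall y, infiniteN y -> subsetN y x -> exists s, initseg_of s y /\ B s)].

Definition hom (B F : seq nat -> Prop) (y : nat -> bool) : Prop :=
  infiniteN y /\
  ((forall s, B s -> all y s -> F s) \/ (forall s, F s -> all y s -> False)).

(* Analytic (Sigma^1_1) subsets of 2^N: projections of closed subsets of
   2^N x N^N.  A closed set is given by a set T of pairs of finite
   approximations: {(x,y) | forall n, T (x|n) (y|n)}. *)
Definition analytic (A : (nat -> bool) -> Prop) : Prop :=
  exists T : seq bool -> seq nat -> Prop,
    forall x, A x <-> exists y : nat -> nat, forall n, T (mkseq x n) (mkseq y n).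

Definition coanalytic (A : (nat -> bool) -> Prop) : Prop :=
  analytic (fun x => ~ A x).

(* Main.v *)
Require Import Defs.
From mathcomp Require Import all_boot.
From mathcomp Require Import boolp.
From mathcomp Require Import zify.

(* Code a colouring F of B by x in 2^N and let b_x = {x|n : n in N}, a subset of
   2^<N identified with N; the sets b_x are infinite and almost disjoint. The
   Nash-Williams argument can be carried out in a Borel way: there is a Borel map
   sending x to an infinite S(x) included in b_x that is homogeneous for the
   colouring coded by x. Let I consist of the z whose trace on every S(x) is
   small, i.e. lies in the copy on S(x), along its increasing enumeration, of a
   fixed Borel tall ideal that contains finite sets and is proper. Then S(x) is
   not in I, and the complement of I is the projection of a Borel set. I is tall:
   if z meets some S(x) in an infinite set, an infinite small subset of that
   intersection meets every other S(x') in a finite set; otherwise z is in I. *)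

Set Implicit Arguments. Unset Strict Implicit. Unset Printing Implicit Defensive.

(** * Closure properties of analytic sets *)

Definition closed_rel (C : (nat -> bool) -> (nat -> nat) -> Prop) : Prop :=
  forall x y,
    (forall n, exists x' y',
       (forall k, k < n -> x k = x' k /\ y k = y' k) /\ C x' y') -> C x y.

(** The tree consists of the finite restrictions of points of [C]; its branches lie in the closure
    of [C], hence in [C]. *)
Lemma closed_rel_analytic C (A : (nat -> bool) -> Prop) : closed_rel C ->
  (forall x, A x <-> exists y, C x y) -> analytic A.
Proof.
move=> cC AC; exists (fun s t => exists x' y',
  [/\ C x' y', s = mkseq x' (size s) & t = mkseq y' (size t)]).
move=> x; rewrite AC; split=> [[y Cxy]|[y Ty]]; exists y.
  by move=> n; exists x, y; rewrite !size_mkseq.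
apply: cC => n; have [x' [y' []]] := Ty n; rewrite !size_mkseq => Cxy ex ey.
exists x', y'; split=> // k kn; split.
  by rewrite -(nth_mkseq false x kn) ex nth_mkseq.
by rewrite -(nth_mkseq 0 y kn) ey nth_mkseq.
Qed.

Lemma analytic_closed_rel (A : (nat -> bool) -> Prop) : analytic A ->
  exists2 C, closed_rel C & forall x, A x <-> exists y, C x y.
Proof.
move=> [T AT]; exists (fun x y => forall n, T (mkseq x n) (mkseq y n)) => //.
move=> x y H n; have [x' [y' [E C]]] := H n.
suff -> : mkseq x n = mkseq x' n.
  suff -> : mkseq y n = mkseq y' n by [].
  by apply/eq_in_map => k; rewrite mem_iota /= add0n => /E[].
by apply/eq_in_map => k; rewrite mem_iota /= add0n => /E[].
Qed.

Lemma analytic_coord n : analytic (fun x => x n).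
Proof.
apply: (@closed_rel_analytic (fun x _ => x n)) => [x y H|x].
  by have [x' [y' [E]]] := H n.+1; have [-> _] := E n (ltnSn n).
by split=> [xn|[]//]; exists (fun=> 0).
Qed.

Lemma coanalytic_coord n : coanalytic (fun x => x n).
Proof.
apply: (@closed_rel_analytic (fun x _ => ~ x n)) => [x y H|x].
  by have [x' [y' [E]]] := H n.+1; have [-> _] := E n (ltnSn n).
by split=> [xn|[]//]; exists (fun=> 0).
Qed.

Lemma analytic_bigcup (A : nat -> (nat -> bool) -> Prop) :
  (forall i, analytic (A i)) -> analytic (fun x => exists i, A i x).
Proof.
move=> aA; have /choice[C HC] : forall i, exists c, closed_rel c /\
    forall x, A i x <-> exists y, c x y.
  by move=> i; have [c] := analytic_closed_rel (aA i); exists c.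
(* The entry [y 0] names the index [i]; the tail of [y] is the witness for [A i]. *)
apply: (@closed_rel_analytic (fun x y => C (y 0) x (fun n => y n.+1))).
  move=> x y H; apply: (HC _).1 => n.
  have [x' [y' [E Cxy]]] := H n.+1.
  exists x', (fun n => y' n.+1); split; last by have [_ ->] := E 0 isT.
  move=> k kn; split; first by have [] := E k (ltnW kn).
  by have [] := E k.+1 kn.
move=> x; split=> [[i /(HC i).2[y Cy]]|[y Cy]].
  by exists (fun n => if n is m.+1 then y m else i).
by exists (y 0); apply/(HC _).2; eexists; exact: Cy.
Qed.

Lemma analytic_bigcap (A : nat -> (nat -> bool) -> Prop) :
  (forall i, analytic (A i)) -> analytic (fun x => forall i, A i x).
Proof.
move=> aA; have /choice[C HC] : forall i, exists c, closed_rel c /\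
    forall x, A i x <-> exists y, c x y.
  by move=> i; have [c] := analytic_closed_rel (aA i); exists c.
(* One [y] stores all witnesses: row [i] sits at the positions [pickle (i, k)]. *)
apply: (@closed_rel_analytic
  (fun x y => forall i, C i x (fun k => y (pickle (i, k))))).
  move=> x y H i; apply: (HC _).1 => n.
  (* Agreement below [N] covers [x] below [n] and the first [n] entries of row [i]. *)
  pose N := maxn n (\max_(k < n) (pickle (i, k : nat)).+1).
  have [x' [y' [E Cxy]]] := H N.
  exists x', (fun k => y' (pickle (i, k))); split=> // k kn; split.
    by have [] := E k (leq_trans kn (leq_maxl _ _)).
  apply: (E _ _).2; apply: leq_trans (leq_maxr _ _).
  exact: (leq_bigmax_cond (F := fun k : 'I_n => (pickle (i, k : nat)).+1)
            (Ordinal kn)).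
move=> x; split=> [Ax|[y Cy] i]; last by apply/(HC _).2; eexists; exact: Cy.
have /choice[Y CY] : forall i, exists y, C i x y by move=> i; apply/(HC i).2.
pose y m := if @unpickle (nat * nat)%type m is Some p then Y p.1 p.2 else 0.
exists y => i; have -> : (fun k => y (pickle (i, k))) = Y i.
  by apply/funext => k; rewrite /y pickleK.
exact: CY.
Qed.

(* The hypothesis on [w] makes [z] the sequence of odd coordinates of [w]. *)
Lemma analytic_proj (A : (nat -> bool) -> Prop) : analytic A ->
  analytic (fun z => exists2 w, A w & forall i, w i.*2.+1 = z i).
Proof.
move=> /analytic_closed_rel[C cC AC].
(* The parity of [v n] carries [w n]; its half carries the witness for [A w]. *)
apply: (@closed_rel_analytic (fun z v =>
  C (fun n => odd (v n)) (fun n => (v n)./2) /\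
  forall i, odd (v i.*2.+1) = z i)) => [z v H|z].
  split=> [|i].
    apply: cC => n; have [z' [v' [E [Cv _]]]] := H n.
    exists (fun n => odd (v' n)), (fun n => (v' n)./2); split=> // k /E[_ ->] //.
  have [z' [v' [E [_ Ov]]]] := H i.*2.+2.
  have [_ ->] := E i.*2.+1 (ltnSn _).
  by have [|-> _] := E i; [lia | exact: Ov].
split=> [[w /AC[y Cwy] wz]|[v [Cv Ov]]].
  exists (fun n => w n + (y n).*2); split=> [|i].
    have -> : (fun n => odd (w n + (y n).*2)) = w.
      by apply/funext => n; rewrite oddD odd_double addbF oddb.
    have -> : (fun n => (w n + (y n).*2)./2) = y.
      by apply/funext => n; rewrite half_bit_double.
    by [].
  by rewrite oddD odd_double addbF oddb.
by exists (fun n => odd (v n)) => //; apply/AC; eexists; exact: Cv.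
Qed.

(** * Borel sets of Cantor space *)

Inductive borel : ((nat -> bool) -> Prop) -> Prop :=
| borel_coord n : borel (fun x => x n)
| borel_not P : borel P -> borel (fun x => ~ P x)
| borel_ex (P : nat -> (nat -> bool) -> Prop) :
    (forall i, borel (P i)) -> borel (fun x => exists i, P i x).

Lemma borel_ext P Q : (forall x, P x <-> Q x) -> borel P -> borel Q.
Proof. by move=> PQ; have -> : P = Q by apply/funext => x; apply/propext. Qed.

Lemma borel_all (P : nat -> (nat -> bool) -> Prop) :
  (forall i, borel (P i)) -> borel (fun x => forall i, P i x).
Proof.
move=> bP; apply: (@borel_ext (fun x => ~ exists i, ~ P i x)).
  move=> x; split=> [nE i|aP [i]]; last by [].
  by apply: contrapT => nP; apply: nE; exists i.
by apply/borel_not/borel_ex => i; apply/borel_not.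
Qed.

Lemma borel_and P Q : borel P -> borel Q -> borel (fun x => P x /\ Q x).
Proof.
move=> bP bQ.
apply: (@borel_ext (fun x => forall i, (if i is 0 then P else Q) x)).
  by move=> x; split=> [H|[Px Qx] []//]; split; [apply: (H 0) | apply: (H 1)].
by apply: borel_all => -[].
Qed.

Lemma borel_imply P Q : borel P -> borel Q -> borel (fun x => P x -> Q x).
Proof.
move=> bP bQ; apply: (@borel_ext (fun x => ~ (P x /\ ~ Q x))).
  move=> x; split=> [H Px|H [Px]]; last by apply; apply: H.
  by apply: contrapT => nQ; apply: H.
by apply/borel_not/borel_and => //; apply: borel_not.
Qed.

Lemma borel_iff P Q : borel P -> borel Q -> borel (fun x => P x <-> Q x).
Proof. by move=> bP bQ; apply: borel_and; apply: borel_imply. Qed.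

Lemma borel_const (Q : Prop) : borel (fun=> Q).
Proof.
have bT : borel (fun=> True).
  apply: (@borel_ext (fun x => x 0 -> x 0)) => //.
  by apply: borel_imply; apply: borel_coord.
have [q|nq] := pselect Q; first by apply: borel_ext bT.
by apply: borel_ext (borel_not bT) => x; split.
Qed.

Lemma borel_reindex (f : nat -> nat) P :
  borel P -> borel (fun x => P (fun n => x (f n))).
Proof.
elim=> [n|{}P _ bP|{}P _ bP]; first exact: (borel_coord (f n)).
  exact: borel_not bP.
exact: (borel_ex bP).
Qed.

Lemma borel_count (f : (nat -> bool) -> nat -> bool) :
  (forall m, borel (fun x => f x m)) ->
  forall M c, borel (fun x => count (f x) (iota 0 M) = c).
Proof.
move=> bf; elim=> [|M IH] c; first exact: (borel_const (0 = c)).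
apply: (@borel_ext (fun x => exists r, count (f x) (iota 0 M) = r /\
          ((f x M -> r.+1 = c) /\ (~ f x M -> r = c)))) => [x|].
  rewrite -[in X in _ <-> X]addn1 iotaD count_cat /= add0n addn0.
  split=> [[r [->]]|<-]; last by eexists; split; [reflexivity|case: (f x M); lia].
  by case: (f x M) => -[]; lia.
apply: borel_ex => r; apply/borel_and => //.
by apply/borel_and; apply: (borel_imply _ (borel_const _)) => //;
  apply: borel_not.
Qed.

(** Complementation swaps the two conclusions, so the induction carries both. *)
Lemma borel_bianalytic P : borel P -> analytic P /\ coanalytic P.
Proof.
elim=> [n|{}P _ [aP cP]|{}P _ aP].
- by split; [apply: analytic_coord | apply: coanalytic_coord].
- split=> //; rewrite /coanalytic.
  by have -> : (fun x => ~ ~ P x) = P by apply/funext => x; rewrite notK.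
- split; first by apply: analytic_bigcup => i; have [] := aP i.
  rewrite /coanalytic.
  have -> : (fun x => ~ exists i, P i x) = (fun x => forall i, ~ P i x).
    by apply/funext => x; apply/propext; split=> [H i Pi|H [i /H]//]; apply: H; exists i.
  by apply: analytic_bigcap => i; have [] := aP i.
Qed.

(** * Borel selection of homogeneous sets *)

Definition unbounded (y : nat -> Prop) : Prop := forall m, exists n, m <= n /\ y n.

Definition least (y : nat -> Prop) n : Prop := y n /\ forall m, y m -> n <= m.

Lemma least_exists y : unbounded y -> exists n, least y n.
Proof.
move=> uy; have ey : exists n, `[< y n >].
  by have [n [_ yn]] := uy 0; exists n; apply/asboolP.
exists (ex_minn ey); case: ex_minnP => n /asboolP yn mn; split=> // m ym.
by apply: mn; apply/asboolP.
Qed.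

Lemma least_uniq y m n : least y m -> least y n -> m = n.
Proof. by move=> [ym lm] [yn ln]; apply/eqP; rewrite eqn_leq lm // ln. Qed.

Definition borel_family (Y : (nat -> bool) -> nat -> Prop) : Prop :=
  forall n, borel (fun x => Y x n).

Lemma borel_least Y : borel_family Y -> forall n, borel (fun x => least (Y x) n).
Proof.
move=> bY n; apply: borel_and => //; apply: borel_all => m.
exact: (borel_imply (bY m) (borel_const _)).
Qed.

Definition borel_unbounded Y : Prop :=
  borel_family Y /\ forall x, unbounded (Y x).

(** The Nash-Williams property above the stem [s], made uniform: shrinking whole Borel families
    keeps both the set and its colour Borel in [x]. *)
Definition selects (B : seq nat -> Prop) (F : (nat -> bool) -> seq nat -> Prop)
    (s : seq nat) : Prop :=
  forall Y, borel_unbounded Y -> exists S c,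
    [/\ borel_unbounded S, borel c, (forall x n, S x n -> Y x n) &
        forall x t, B (s ++ t) -> (forall m, m \in t -> S x m) ->
          (F x (s ++ t) <-> c x)].

(* One step of the construction of a homogeneous set: take the least element [n]
   of [Y x] and shrink the rest so that the colour of [rcons s n ++ t] no longer
   depends on [t]. *)
Definition refines B F s Y (p : ((nat -> bool) -> nat -> Prop) *
    ((nat -> bool) -> Prop)) : Prop :=
  [/\ borel_unbounded p.1, borel p.2,
      (forall x n k, least (Y x) n -> p.1 x k -> Y x k /\ n < k) &
      forall x n t, least (Y x) n -> B (rcons s n ++ t) ->
        (forall m, m \in t -> p.1 x m) -> (F x (rcons s n ++ t) <-> p.2 x)].

(** Selection is applied for each candidate [n] to the part of [Y x] above [n]. The results are
    glued according to the actual least element; the gluing is a countable union, hence Borel. *)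
Lemma selects_refines B F s : (forall n, selects B F (rcons s n)) ->
  forall Y, borel_unbounded Y -> exists p, refines B F s Y p.
Proof.
move=> sel Y [bY uY].
have /choice[p Hp] : forall n, exists p : ((nat -> bool) -> nat -> Prop) *
    ((nat -> bool) -> Prop),
    [/\ borel_unbounded p.1, borel p.2,
        (forall x k, p.1 x k -> Y x k /\ n < k) &
        forall x t, B (rcons s n ++ t) -> (forall m, m \in t -> p.1 x m) ->
          (F x (rcons s n ++ t) <-> p.2 x)].
  move=> n; have [|S [c H]] := sel n (fun x k => Y x k /\ n < k).
    split=> [k|x m]; first exact: (borel_and (bY k) (borel_const _)).
    by have [k [mk Yk]] := uY x (maxn m n.+1); exists k; split; [lia|split; [|lia]].
  by exists (S, c).
exists (fun x k => exists n, least (Y x) n /\ (p n).1 x k,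
        fun x => exists n, least (Y x) n /\ (p n).2 x).
have E x n (Q : nat -> Prop) : least (Y x) n ->
    (exists m, least (Y x) m /\ Q m) <-> Q n.
  by move=> ln; split=> [[m [/(least_uniq ln)<-]] //|Qn]; exists n.
split=> /=.
- split=> [k|x m].
    apply: borel_ex => n; apply: borel_and; first exact: borel_least.
    by have [[bp _] _ _ _] := Hp n; apply: bp.
  have [n ln] := least_exists (uY x).
  have [[_ up] _ _ _] := Hp n; have [k [mk pk]] := up x m.
  by exists k; split=> //; exists n.
- apply: borel_ex => n; apply: borel_and; first exact: borel_least.
  by have [_ bp _ _] := Hp n.
- move=> x n k ln /(E _ _ (fun m => (p m).1 x k) ln).
  by have [_ _ H _] := Hp n; apply: H.
- move=> x n t ln Bt Ht; rewrite (E _ _ (fun m => (p m).2 x) ln).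
  have [_ _ _ H] := Hp n; apply: H => // m mt.
  by apply/(E _ _ (fun n => (p n).1 x m) ln)/Ht.
Qed.

(** A fusion argument: iterated refinement yields increasing least elements, the colour of a set
    depends only on the stage of its first element after [s], and stages of one colour are kept. *)
Lemma selects_rcons B F s : (forall t, B t -> finsetN t) -> ~ B s ->
  (forall n, selects B F (rcons s n)) -> selects B F s.
Proof.
move=> finB nBs sel Y gY.
(* Choice needs a value at every [Y]; the pair [(Z, fun=> True)] is a dummy outside the intended
   domain. *)
have /choice[f Hf] : forall Y, exists p, borel_unbounded Y -> refines B F s Y p.
  move=> Z; have [gZ|nZ] := pselect (borel_unbounded Z).
    by have [p] := selects_refines sel gZ; exists p.
  by exists (Z, fun=> True).
pose Z i := iter i (fun Z => (f Z).1) Y.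
have gZ i : borel_unbounded (Z i).
  by elim: i => //= i /Hf[].
have rZ i : refines B F s (Z i) (f (Z i)) by apply: Hf.
pose c i := (f (Z i)).2.
have ZS i x n k : least (Z i x) n -> Z i.+1 x k -> Z i x k /\ n < k.
  by have [_ _ H _] := rZ i; apply: H.
have subZ i j x k : Z (i + j) x k -> Z i x k.
  elim: j k => [|j IH] k; first by rewrite addn0.
  rewrite addnS; have [n ln] := least_exists ((gZ (i + j)).2 x).
  by by move=> /(ZS _ _ _ _ ln)[Zk _]; exact: IH.
have least_lt i j x m n : i < j -> least (Z i x) m -> least (Z j x) n -> m < n.
  move=> /subnKC <- lm [Zn _].
  by have [] := ZS i x m n lm (subZ i.+1 (j - i.+1) x n Zn).
have least_ge i x n : least (Z i x) n -> i <= n.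
  elim: i n => // i IH n ln; have [m lm] := least_exists ((gZ i).2 x).
  exact: leq_ltn_trans (IH m lm) (least_lt _ _ _ _ _ (ltnSn i) lm ln).
(* The colour that occurs infinitely often among the [c i x], true if both do. *)
pose col x := forall j, exists i, j <= i /\ c i x.
have bcol : borel col.
  apply: borel_all => j; apply: borel_ex => i; apply: borel_and.
    exact: borel_const.
  by have [_ H _ _] := rZ i.
exists (fun x k => exists i, least (Z i x) k /\ (c i x <-> col x)), col.
split=> //.
- split=> [k|x m].
    apply: borel_ex => i; apply: borel_and.
      by apply: borel_least; have [] := gZ i.
    by apply: borel_iff => //; have [_ H _ _] := rZ i.
  have [i [mi Ei]] : exists i, m <= i /\ (c i x <-> col x).
    have [cx|ncx] := pselect (col x).
      by have [i [mi ci]] := cx m; exists i; split.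
    have [j Hj] : exists j, forall i, j <= i -> ~ c i x.
      apply: contrapT => nE; apply: ncx => j; apply: contrapT => nj.
      by apply: nE; exists j => i ji ci; apply: nj; exists i.
    exists (maxn j m); split; first exact: leq_maxr.
    by split=> // /Hj; rewrite leq_maxl => /(_ isT).
  have [k lk] := least_exists ((gZ i).2 x).
  by exists k; split; [apply: leq_trans (least_ge _ _ _ lk) | exists i].
- move=> x k [i [[Zk _] _]]; exact: (subZ 0 i).
(* The empty [t] is excluded by [~ B s]. Otherwise the stage [i] of [a] fixes the colour, and the
   later elements come from later stages, so they lie in [Z i.+1 x]. *)
- move=> x [|a t]; first by rewrite cats0.
  move=> Bt Ht; have [i [la <-]] := Ht a (mem_head _ _).
  have [_ _ _ H] := rZ i; rewrite -cat_rcons; apply: H => //.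
    by rewrite cat_rcons.
  move=> m mt; have [j [lm _]] : exists j, least (Z j x) m /\ (c j x <-> col x).
    by apply: Ht; rewrite inE mt orbT.
  have am : a < m.
    move: (finB _ Bt); rewrite /finsetN => /(subseq_sorted ltn_trans).
    move=> /(_ (a :: t) (suffix_subseq _ _)) /=.
    by move=> /(order_path_min ltn_trans)/allP/(_ m mt).
  have ij : i < j.
    rewrite ltnNge leq_eqVlt; apply/negP => /orP[/eqP eji|ji].
      by move: am; rewrite eji in lm; rewrite (least_uniq la lm) ltnn.
    by have := least_lt _ _ _ _ _ ji lm la; lia.
  by apply: (subZ i.+1 (j - i.+1)); rewrite subnKC //; case: lm.
Qed.

Lemma sorted_ltn_leq_nth (s : seq nat) i : sorted ltn s -> i < size s -> i <= nth 0 s i.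
Proof.
move=> so; elim: i => // i IH si; apply: leq_ltn_trans (IH (ltnW si)) _.
by apply: (sorted_ltn_nth ltn_trans) => //; rewrite inE ltnW.
Qed.

(** An entry of a strictly increasing list is at least its index. *)
Lemma sorted_ltn_cat_size (u v : seq nat) k :
  sorted ltn (u ++ v) -> k \in v -> size u <= k.
Proof.
move=> so kv; rewrite -(nth_index 0 kv) -(addKn (size u) (index k v)).
have := @sorted_ltn_leq_nth _ (size u + index k v) so.
rewrite size_cat ltn_add2l index_mem kv nth_cat ltnNge leq_addr /= => /(_ isT).
exact: leq_trans (leq_addr _ _).
Qed.

(** The cut is at the first entry of [t], or just above the maximum of [s] if [t] is empty. *)
Lemma initseg_cat s t : finsetN (s ++ t) -> initseg s (s ++ t).
Proof.
case: t => [|a t]; first by exists (\max_(k <- s) k).+1; rewrite cats0; symmetry;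
  apply/all_filterP/allP => k ks; rewrite ltnS leq_bigmax_seq.
rewrite /finsetN (sorted_pairwise ltn_trans) pairwise_cat => /and3P[/allrelP sa _].
rewrite pairwise_cons => /andP[/allP at_ _]; exists a.
rewrite filter_cat /= ltnn (@eq_in_filter _ _ pred0 t) => [|k /at_]; last first.
  by rewrite /= => /ltnW; rewrite leqNgt => /negbTE.
rewrite filter_pred0 cats0; symmetry; apply/all_filterP/allP => k ks.
by apply: sa; rewrite ?mem_head.
Qed.

(* A bad sequence, along which selection fails, would enumerate an infinite set
   with no initial segment in [B]. *)
Lemma selects_nil B F :
  (forall s, borel (fun x => F x s)) -> front B (fun=> true) -> selects B F [::].
Proof.
move=> bF [_ finB antiB frB]; apply: contrapT => nsel.
have fin t : B t -> finsetN t by move=> /finB[].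
(* For [s] in [B], incomparability leaves only the empty [t], so the colour is that of [s]. *)
have nB s : ~ selects B F s -> ~ B s.
  move=> ns Bs; apply: ns => Y gY; exists Y, (fun x => F x s); split=> // x t Bt _.
  suff <- : s = s ++ t by [].
  by apply: antiB => //; apply/initseg_cat/fin.
(* A stem with no extension in [B] satisfies selection vacuously. *)
have exB s : ~ selects B F s -> exists t, B (s ++ t).
  move=> ns; apply: contrapT => nE; apply: ns => Y gY; exists Y, (fun=> True).
  by split=> // [|x t Bt]; [exact: borel_const | case: nE; exists t].
have /choice[g Hg] : forall s, exists n,
    ~ selects B F s -> ~ selects B F (rcons s n).
  move=> s; apply: contrapT => nE; apply: (nE); exists 0 => ns; exfalso.
  apply: (ns); apply: selects_rcons (nB _ ns) _ => // n.
  by apply: contrapT => nn; apply: nE; exists n.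
pose u i := iter i (fun s => rcons s (g s)) [::].
have nu i : ~ selects B F (u i) by elim: i => //= i; apply: Hg.
have su i : size (u i) = i by elim: i => //= i IH; rewrite size_rcons IH.
have uD i j : exists t, u (i + j) = u i ++ t.
  elim: j => [|j [t IH]]; first by exists [::]; rewrite addn0 cats0.
  by exists (rcons t (g (u (i + j)))); rewrite addnS /= {1}IH rcons_cat.
have sou i : sorted ltn (u i).
  have [t /fin] := exB _ (nu i); rewrite /finsetN => so.
  exact: subseq_sorted ltn_trans _ _ (prefix_subseq _ _) so.
pose y m := `[< exists i, m \in u i >].
have [|//|s [[n es] Bs]] := frB y.
  move=> m; exists (g (u m)); split; last first.
    by apply/asboolP; exists m.+1; rewrite /= mem_rcons mem_head.
  rewrite -{1}(su m); apply: (@sorted_ltn_cat_size _ [:: g (u m)]).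
    by rewrite cats1; apply: (sou m.+1).
  exact: mem_head.
(* The list [u n.+1] already contains every element of [y] below [n], and [t] has none below [n]. So
   [s] is an initial segment of [u n.+1 ++ t]; it is proper, having at most [n] elements. *)
have [t Bt] := exB _ (nu n.+1).
have sot : sorted ltn (u n.+1 ++ t) by apply: fin.
have /antiB : initseg s (u n.+1 ++ t).
  exists n; apply: (irr_sorted_eq ltn_trans ltnn).
  - by have := fin _ Bs.
  - exact: sorted_filter ltn_trans _ _ sot.
  move=> k; rewrite es !mem_filter mem_iota add0n leq0n andTb andbC.
  have [kn|//] := ltnP k n; rewrite !andTb mem_cat.
  have -> : (k \in t) = false.
    apply/negP => /(sorted_ltn_cat_size sot); rewrite su; lia.
  rewrite orbF; apply/asboolP/idP => [[j kj]|ku]; last by exists n.+1.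
  have [jn|nj] := leqP j n.+1.
    by have [v] := uD j (n.+1 - j); rewrite subnKC // => ->; rewrite mem_cat kj.
  have [v ev] := uD n.+1 (j - n.+1); rewrite subnKC 1?ltnW // in ev.
  move: kj; rewrite ev mem_cat => /orP[//|kv].
  have := @sorted_ltn_cat_size (u n.+1) v k; rewrite -ev su => /(_ (sou j) kv).
  lia.
move=> /(_ Bs Bt) /(congr1 size); rewrite size_cat su es size_filter.
move=> e; have := leq_trans (eq_leq (esym e)) (count_size y (iota 0 n)).
by rewrite size_iota; lia.
Qed.

(** * A proper tall ideal copied onto an infinite set *)

Definition rank (S : nat -> bool) (m : nat) : nat := count S (iota 0 m).

Definition block (S z : nat -> bool) n m : bool := [&& z m, S m & trunc_log 2 (rank S m) == n].

(* The copy on [S] of the ideal ED_fin, with blocks [2^n <= rank < 2^(n+1)]; the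
   junk value [trunc_log 2 0 = 0] puts rank 0 in block 0. *)
Definition small_on (S z : nat -> bool) : Prop :=
  exists c, forall n M, count (block S z n) (iota 0 M) <= c.

Lemma rankS S m : rank S m.+1 = rank S m + S m.
Proof. by rewrite /rank -addn1 iotaD count_cat /= addn0. Qed.

Lemma rank_leq S m : rank S m <= m.
Proof. by rewrite -{2}(size_iota 0 m) count_size. Qed.

Lemma rank_mono S m n : m <= n -> rank S m <= rank S n.
Proof. by move=> /subnKC<-; rewrite /rank iotaD count_cat leq_addr. Qed.

Lemma rank_unbounded S r : infiniteN S -> exists m, r <= rank S m.
Proof.
move=> iS; elim: r => [|r [m rm]]; first by exists 0.
have [n [mn Sn]] := iS m; exists n.+1; rewrite rankS Sn.
by have := rank_mono S mn; lia.
Qed.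

(** Change of variable: [rank S] maps the elements of [S] below [M] bijectively onto the numbers
    below [rank S M]. *)
Lemma count_rank S (p : pred nat) M :
  count (fun m => S m && p (rank S m)) (iota 0 M) = count p (iota 0 (rank S M)).
Proof.
elim: M => // M IH; rewrite rankS -addn1 !iotaD !count_cat IH /= add0n addn0.
by case: (S M); rewrite //= addn0.
Qed.

(** Block [c] has at least [2 ^ c] elements, which exceeds the proposed bound [c]. *)
Lemma not_small_on_self S : infiniteN S -> ~ small_on S S.
Proof.
move=> iS [c Hc]; have [M hM] := rank_unbounded (2 ^ c.+1) iS.
have := Hc c M; rewrite leqNgt => /negP; apply.
apply: (@leq_trans (2 ^ c)); first exact: ltn_expl.
rewrite (@eq_count _ _ (fun m => S m && (trunc_log 2 (rank S m) == c))); last first.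
  by move=> m; rewrite /block andbA andbb.
rewrite (count_rank S (fun r => trunc_log 2 r == c)).
(* The ranks are cut at [2 ^ c] and [2 ^ c.+1]; the middle piece lies in block [c]. *)
have -> : rank S M = 2 ^ c + (2 ^ c + (rank S M - 2 ^ c.+1)).
  by rewrite addnA addnn -mul2n -expnS subnKC.
rewrite !iotaD !count_cat add0n addnCA; apply: leq_trans (leq_addr _ _).
rewrite -{1}(size_iota (2 ^ c) (2 ^ c)) leq_eqVlt eq_sym -all_count.
apply/orP; left; apply/allP => r; rewrite mem_iota addnn -mul2n -expnS.
by move=> /(trunc_log_eq (ltnSn 1))->.
Qed.

Lemma small_on_bounded (S z : nat -> bool) N : (forall m, z m -> S m -> m < N) -> small_on S z.
Proof.
move=> zS; exists N => n M; rewrite (@leq_trans (count (fun m => m < N) (iota 0 M))) //.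
  by apply: sub_count => m /and3P[/zS mN /mN].
elim: M => // M; rewrite -addn1 iotaD count_cat /= add0n addn0.
have := count_size (fun m => m < N) (iota 0 M); rewrite size_iota.
by case: ltnP; lia.
Qed.

Lemma small_on_finite (S z : nat -> bool) : ~ infiniteN (fun m => z m && S m) -> small_on S z.
Proof.
move=> nI; apply: contrapT => ns; apply: nI => N; apply: contrapT => nE.
apply: ns; apply: (@small_on_bounded _ _ N) => m zm Sm; rewrite ltnNge.
by apply/negP => Nm; apply: nE; exists m; rewrite zm Sm.
Qed.

Lemma small_on_sub S y z : subsetN y z -> small_on S z -> small_on S y.
Proof.
move=> yz [c Hc]; exists c => n M; apply: leq_trans (Hc n M).
by apply: sub_count => m /and3P[/yz zm Sm e]; apply/and3P.
Qed.

Lemma small_on_union S y z : small_on S y -> small_on S z ->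
  small_on S (fun n => y n || z n).
Proof.
move=> [c Hc] [d Hd]; exists (c + d) => n M.
apply: leq_trans (leq_add (Hc n M) (Hd n M)).
rewrite -count_predUI; apply: leq_trans (leq_addr _ _).
by apply: sub_count => m; rewrite /block /= andb_orl.
Qed.

(** The set [y] takes the least element of [Z] in each block that meets [Z], so the bound is 1. *)
Lemma small_on_tall (S z : nat -> bool) : infiniteN (fun m => z m && S m) ->
  exists y, [/\ infiniteN y, subsetN y (fun m => z m && S m) & small_on S y].
Proof.
move=> iz; pose Z m := z m && S m; pose l m := trunc_log 2 (rank S m).
pose y m := Z m && all (fun k => Z k ==> (l k != l m)) (iota 0 m).
have yinj a b : y a -> y b -> l a = l b -> a = b.
  wlog ab : a b / a < b => [H ya yb e|/andP[Za _] /andP[_ /allP/(_ a)] H e].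
    have [lt_ab|lt_ba|//] := ltngtP a b; first exact: H.
    by symmetry; apply: H.
  by move: H; rewrite mem_iota ab Za e eqxx => /(_ isT).
exists y; split=> [N|m /andP[]//|].
  (* An element of rank at least [2 ^ N] lies in a block of index at least [N], and the least
     element of [Z] in that block is at least [N]. *)
  have [N' hN'] : exists m, 2 ^ N <= rank S m.
    by apply: rank_unbounded => m; have [n [mn /andP[_ Sn]]] := iz m; exists n.
  have [m [mN' Zm]] := iz N'.
  have ex : exists k, Z k && (l k == l m) by exists m; rewrite eqxx andbT.
  case: (ex_minnP ex) => k /andP[Zk /eqP lk] mink; exists k; split; last first.
    rewrite /y Zk; apply/allP => j; rewrite mem_iota /= add0n => jk.
    apply/implyP => Zj; apply/eqP => ljk.
    by move: (mink j); rewrite Zj ljk lk eqxx leqNgt jk => /(_ isT).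
  have hr : 2 ^ N <= rank S m by apply: leq_trans hN' (rank_mono _ mN').
  have Nl : N <= l k.
    by rewrite lk /l trunc_log_max.
  (* Rank 0 lies in block 0 by the default value of [trunc_log], which forces [N = 0]. *)
  have [r0|r1] := posnP (rank S k).
    by move: Nl; rewrite /l r0 trunc_log0; lia.
  apply: leq_trans (rank_leq S k); apply: leq_trans (trunc_logP (ltnSn 1) r1).
  by apply: leq_trans Nl _; apply/ltnW/ltn_expl.
exists 1 => n M; have [[a pa]|np] := pselect (exists a, block S y n a).
  rewrite (@leq_trans (count (pred1 a) (iota 0 M))) //.
    apply: sub_count => b /and3P[yb _ /eqP lb] /=; apply/eqP.
    by case/and3P: pa => ya _ /eqP la; apply: yinj => //; rewrite /l lb la.
  by rewrite (count_uniq_mem _ (iota_uniq _ _)); case: (_ \in _).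
rewrite (@eq_count _ _ pred0) ?count_pred0 // => a /=.
by apply/negP => pa; apply: np; exists a.
Qed.

(** * Almost disjoint branches and Borel complexity *)

Definition branch (x : nat -> bool) (m : nat) : Prop :=
  exists n, m = pickle (mkseq x n).

(** Only finitely many values of [mkseq x n] occur, so any [Q] gives a clopen set. *)
Lemma borel_mkseq n (Q : seq bool -> Prop) : borel (fun x => Q (mkseq x n)).
Proof.
elim: n Q => [|n IH] Q; first exact: (borel_const (Q [::])).
apply: (@borel_ext (fun x => (x n -> Q (rcons (mkseq x n) true)) /\
                             (~ x n -> Q (rcons (mkseq x n) false)))) => [x|].
  rewrite mkseqS; case: (x n).
    by split=> [[Ht _]|Q1]; [apply: Ht | split].
  by split=> [[_ Hf]|Q0]; [apply: Hf | split].
apply: borel_and; apply: borel_imply; try exact: borel_coord.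
- exact: (IH (fun s => Q (rcons s true))).
- exact/borel_not/borel_coord.
- exact: (IH (fun s => Q (rcons s false))).
Qed.

Lemma pickle_mkseq_inj (x x' : nat -> bool) n n' :
  pickle (mkseq x n) = pickle (mkseq x' n') -> n = n' /\ mkseq x n = mkseq x' n'.
Proof.
move=> /(pcan_inj pickleK) e; split=> //.
by have := congr1 size e; rewrite !size_mkseq.
Qed.

Lemma branch_borel_unbounded : borel_unbounded branch.
Proof.
split=> [m|x m].
  by apply: borel_ex => n; exact: (borel_mkseq n (fun s => m = pickle s)).
apply: contrapT => nE.
(* Pigeonhole: [m.+1] distinct codes cannot all be below [m]. *)
pose code n := pickle (mkseq x n).
have ui : uniq (map code (iota 0 m.+1)).
  by rewrite map_inj_uniq ?iota_uniq // => i j /pickle_mkseq_inj[].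
have /(uniq_leq_size ui) : {subset map code (iota 0 m.+1) <= iota 0 m}.
  move=> k /mapP[n _ ->]; rewrite mem_iota /= add0n ltnNge; apply/negP => mk.
  by apply: nE; exists (code n); split=> //; exists n.
by rewrite size_map !size_iota ltnn.
Qed.

(** A common code larger than those of the first [i.+1] restrictions of [x] codes a restriction
    longer than [i], so [x] and [x'] agree at [i]. *)
Lemma branch_almost_disjoint x x' :
  unbounded (fun m => branch x m /\ branch x' m) -> x = x'.
Proof.
move=> ub; apply/funext => i.
have [m [Nm [[n em] [n' em']]]] :=
  ub (\max_(n < i.+1) pickle (mkseq x n)).+1.
have ni : i < n.
  rewrite ltnNge; apply/negP => ni; move: Nm; rewrite em ltnNge => /negP; apply.
  exact: (leq_bigmax_cond (F := fun n : 'I_i.+1 => pickle (mkseq x n))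
            (Ordinal (ni : n < i.+1))).
have [nn' e] : n = n' /\ mkseq x n = mkseq x' n'.
  by apply: pickle_mkseq_inj; rewrite -em.
by rewrite -(nth_mkseq false x ni) e nth_mkseq -?nn'.
Qed.

(** The pair of a parameter and a set is interleaved into one point [w]: even coordinates for the
    parameter, odd ones for the set. *)
Lemma borel_small_on (S : (nat -> bool) -> nat -> bool) :
  (forall m, borel (fun x => S x m)) ->
  borel (fun w => small_on (S (fun n => w n.*2)) (fun n => w n.*2.+1)).
Proof.
move=> bS; have bS2 m : borel (fun w => S (fun n => w n.*2) m).
  exact: (borel_reindex double (bS m)).
apply: borel_ex => c; apply: borel_all => n; apply: borel_all => M.
set f := fun w : nat -> bool => block (S (fun n => w n.*2)) (fun n => w n.*2.+1) n.
apply: (@borel_ext (fun w => exists k, count (f w) (iota 0 M) = k /\ k <= c)).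
  by move=> w; split=> [[k [<-]]|] //; exists (count (f w) (iota 0 M)).
apply: borel_ex => k; apply: borel_and (borel_const _).
apply: borel_count => m.
apply: (@borel_ext (fun w => w m.*2.+1 /\ (S (fun n => w n.*2) m /\
  exists r, count (S (fun n => w n.*2)) (iota 0 m) = r /\ trunc_log 2 r = n))).
  move=> w; split=> [[wm [Sm [r [er lr]]]]|/and3P[wm Sm /eqP lr]].
    by apply/and3P; split=> //; rewrite /rank er lr.
  by split=> //; split=> //; eexists; split; first reflexivity.
apply: borel_and; first exact: borel_coord.
apply: borel_and => //; apply: borel_ex => r.
by apply: borel_and (borel_const _); apply: borel_count.
Qed.

(** * The co-analytic tall ideal *)

Theorem mainTheorem5 (B : seq nat -> Prop) :
  front B (fun _ => true) ->
  exists I : (nat -> bool) -> Prop,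
    [/\ is_ideal I, tall I, coanalytic I &
        forall F : seq nat -> Prop, (forall s, F s -> B s) ->
          ~ (forall y, hom B F y -> I y)].
Proof.
move=> frB; pose Fx (x : nat -> bool) (s : seq nat) : Prop := x (pickle s).
have [S [c [[bS uS] _ subS homS]]] :=
  selects_nil (fun s => borel_coord (pickle s) : borel (fun x => Fx x s)) frB
    branch_borel_unbounded.
pose T x m := `[< S x m >].
have bT m : borel (fun x => T x m).
  by apply: borel_ext (bS m) => x; split=> [|/asboolP]//; move/asboolP.
have iT x : infiniteN (T x).
  by move=> m; have [n [mn Sn]] := uS x m; exists n; split=> //; apply/asboolP.
have adT x x' y : subsetN y (T x) -> infiniteN (fun m => y m && T x' m) -> x = x'.
  move=> yT iy; apply: branch_almost_disjoint => m.
  have [n [mn /andP[/yT/asboolP Sn /asboolP Sn']]] := iy m.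
  by exists n; split=> //; split; apply: subS.
exists (fun z => forall x, small_on (T x) z); split.
- split=> [y z Iy zy x|y z Iy Iz x]; first exact: small_on_sub (Iy x).
  exact: small_on_union.
- move=> z iz; have [[x ix]|nx] := pselect (exists x, infiniteN (fun m => z m && T x m)).
    have [y [iy yz sy]] := small_on_tall ix; exists y; split=> //.
      by move=> m /yz/andP[].
    (* Since [y] lies inside [T x], only [x' = x] can give an infinite trace. *)
    move=> x'; have [iy'|] := pselect (infiniteN (fun m => y m && T x' m)).
      by have <- // : x = x'; apply: adT iy' => m /yz/andP[].
    exact: small_on_finite.
  by exists z; split=> // x; apply: small_on_finite => ix; apply: nx; exists x.
- pose Q w := ~ small_on (T (fun n => w n.*2)) (fun n => w n.*2.+1).
  have /analytic_proj : analytic Q by have [] := borel_bianalytic (borel_not (borel_small_on bT)).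
  rewrite /coanalytic; congr analytic; apply/funext => z; apply/propext.
  split=> [[w Qw wz] Iz|nIz].
    by apply: Qw; have -> : (fun n => w n.*2.+1) = z by apply/funext.
  have [x nx] : exists x, ~ small_on (T x) z.
    by apply: contrapT => nE; apply: nIz => x; apply: contrapT => nx; apply: nE; exists x.
  (* The witness [x] is interleaved with [z]. *)
  exists (fun n => if odd n then z n./2 else x n./2).
    rewrite /Q; set x1 := fun n => _; set z1 := fun n => _.
    have -> : x1 = x by apply/funext => n; rewrite /x1 odd_double doubleK.
    have -> // : z1 = z.
    by apply/funext => n; rewrite /z1 /= odd_double /= uphalf_double.
  by move=> i; rewrite /= odd_double /= uphalf_double.
(* With [x] the code of [F], the set [T x] is homogeneous for [F] but not small on itself. *)
- move=> F FB HI; pose x n := `[< exists s, pickle s = n /\ F s >].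
  have xF s : Fx x s <-> F s.
    split=> [/asboolP[t [/(pcan_inj pickleK) -> //]]|Fs].
    by apply/asboolP; exists s.
  apply: (not_small_on_self (iT x)); apply: HI; split=> //.
  have Hs s : B s -> all (T x) s -> (F s <-> c x).
    move=> Bs /allP Ts; rewrite -xF; apply: (homS x s) => // m /Ts.
    by move/asboolP.
  have [cx|ncx] := pselect (c x); [left|right] => s Hb /Hs H.
    by apply/H.
  by apply: ncx; apply/H => //; apply: FB.
Qed.
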